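(* Let $f$ be a face with $\dim f \ge 1$, $k \in f$, and $s \in \{0,1\}^{D+1}$ with $\operatorname{supp}(s) \cup \{k\} = f$. The directional form $\psi(\xi; f,k,s)$ fails to be anchored if and only if $\operatorname{supp}(s) = f$ and $k = \min f$. In particular, a triplet $(f,k,\alpha) \in \mathcal{S}(\Delta_\xi, r)$ lies in $\mathcal{B}(\Delta_\xi, r)$ if and only if $\operatorname{supp}(\alpha) \neq f$ or $k \neq \min f$.
   Context: $D \ge 1$ and $r \ge 1$ are integers and $\Delta_\xi$ is a non-degenerate $D$-simplex in $\mathbb{R}^D$ with vertex labels $0,\dots,D$, naturally ordered, and barycentric coordinates $\xi_0,\dots,\xi_D$. A face is identified with its label set $f \subseteq \{0,\dots,D\}$; $\dim f = |f|-1$, $\min f$ is the smallest label, $f\setminus k$ means $f \setminus\{k\}$. For a vector $\alpha \in \mathbb{N}_0^{D+1}$, $|\alpha| = \sum_i\alpha_i$, $\operatorname{supp}(\alpha) = \{i : \alpha_i > 0\}$, and $\mathbf{1}_\alpha \in \{0,1\}^{D+1}$ has $(\mathbf{1}_\alpha)_i = 1$ iff $\alpha_i > 0$. For $f,k,s$ with $\dim f\ge 1$, $k \in f$, $s \in \{0,1\}^{D+1}$, $\operatorname{supp}(s)\cup\{k\} = f$, the directional form is $\psi(\xi; f,k,s) = \mathrm{d}\xi_k - \frac{s_k}{|s|}\sum_{j\in f}\mathrm{d}\xi_j$. It (that is, its argument $(f,k,s)$) is called anchored if $s_i = 0$ for all $i < \min(f\setminus k)$. $\mathcal{S}(\Delta_\xi,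 r)$ is the set of triplets $(f,k,\alpha)$ with $\dim f \ge 1$, $k \in f$, $\alpha \in \mathbb{N}_0^{D+1}$, $|\alpha| = r$ and $\operatorname{supp}(\alpha)\cup\{k\} = f$. $\mathcal{B}(\Delta_\xi, r)$ is the subset of those triplets for which $\psi(\xi; f,k,\mathbf{1}_\alpha)$ is anchored. *)

(* Defs.v *)
From HB Require Import structures.
From mathcomp Require Import all_boot all_order all_algebra.
From mathcomp Require Import all_classical all_reals all_analysis.
Set Implicit Arguments.
Unset Strict Implicit.
Unset Printing Implicit Defensive.
Import Order.TTheory GRing.Theory Num.Theory.
Import numFieldNormedType.Exports.
Local Open Scope ring_scope.

(* The rows of [edges v] are the vectors from vertex 0 to the other vertices. *)
Definition edges (R : realType) (D : nat) (v : 'I_D.+1 -> 'rV[R]_D) : 'M[R]_D :=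
  \matrix_(j < D) (v (lift ord0 j) - v ord0).

Record simplex (R : realType) (D : nat) := Simplex {
  vertex :> 'I_D.+1 -> 'rV[R]_D;
  simplex_nondegenerate : row_free (edges vertex)
}.

(* Coordinates of x - v_0 in the basis of edges give xi_1, ..., xi_D, and
   xi_0 = 1 - (xi_1 + ... + xi_D). *)
Definition bary (R : realType) (D : nat) (Delta : simplex R D)
    (i : 'I_D.+1) (x : 'rV[R]_D) : R :=
  let c := (x - Delta ord0) *m invmx (edges Delta) in
  if unlift ord0 i is Some j then c 0 j else 1 - \sum_j c 0 j.

Section BaryTheory.
Variables (R : realType) (D : nat) (Delta : simplex R D).

Let coords (x : 'rV[R]_D) := (x - Delta ord0) *m invmx (edges Delta).

Let bary0 x : bary Delta ord0 x = 1 - \sum_j coords x 0 j.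
Proof. by rewrite /bary unlift_none. Qed.

Let baryS j x : bary Delta (lift ord0 j) x = coords x 0 j.
Proof. by rewrite /bary liftK. Qed.

Lemma sum_bary x : \sum_i bary Delta i x = 1.
Proof.
rewrite big_ord_recl bary0 (eq_bigr _ (fun j _ => baryS j x)).
by rewrite subrK.
Qed.

Lemma bary_comb x : \sum_i bary Delta i x *: Delta i = x.
Proof.
have eU : edges Delta \in unitmx.
  by rewrite -row_free_unit simplex_nondegenerate.
have : coords x *m edges Delta = x - Delta ord0 by rewrite mulmxKV.
rewrite big_ord_recl bary0 mulmx_sum_row.
rewrite (eq_bigr (fun j => coords x 0 j *: Delta (lift ord0 j)
  - coords x 0 j *: Delta ord0)); last by move=> j _; rewrite rowK scalerBr.
rewrite sumrB -scaler_suml => h.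
rewrite (eq_bigr (fun j => coords x 0 j *: Delta (lift ord0 j)));
  last by move=> j _; rewrite baryS.
by rewrite scalerBl scale1r -addrA [X in _ + X]addrC h addrC subrK.
Qed.

Let bary_affine i : exists (a : 'I_D -> R) (b : R),
  forall x, bary Delta i x = \sum_j a j * x 0 j + b.
Proof.
have cE j x : coords x 0 j = \sum_k invmx (edges Delta) k j * x 0 k
    - \sum_k invmx (edges Delta) k j * Delta ord0 0 k.
  rewrite mxE -sumrB; apply: eq_bigr => k _.
  by rewrite !mxE mulrC mulrBr.
case: (unliftP ord0 i) => [j ->|->].
  exists (fun k => invmx (edges Delta) k j).
  exists (- \sum_k invmx (edges Delta) k j * Delta ord0 0 k) => x.
  by rewrite baryS cE.
exists (fun k => - \sum_j invmx (edges Delta) k j).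
exists (1 + \sum_j \sum_k invmx (edges Delta) k j * Delta ord0 0 k) => x.
rewrite bary0 (eq_bigr _ (fun j _ => cE j x)) sumrB opprB addrA [RHS]addrC.
congr (_ + _); rewrite exchange_big -sumrN; apply: eq_bigr => k _.
by rewrite mulNr mulr_suml.
Qed.

Lemma diff_bary i x v :
  'd (bary Delta i) x v = bary Delta i (x + v) - bary Delta i x.
Proof.
have [a [b ab]] := bary_affine i.
pose l (y : 'rV[R]_D) := \sum_j a j * y 0 j.
have llin : linear l.
  move=> c y z; rewrite /l scaler_sumr -big_split; apply: eq_bigr => k _.
  by rewrite !mxE mulrDr mulrCA.
pose L : {linear 'rV[R]_D -> R} := HB.pack l (GRing.isLinear.Build _ _ _ _ l llin).
have lc : continuous L.
  have h (r : seq 'I_D) :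
      continuous (fun y : 'rV[R]_D => \sum_(j <- r) a j * y 0 j).
    elim: r => [|j r IH].
      rewrite (_ : (fun _ => _) = cst 0); first exact: cst_continuous.
      by apply/funext => z; rewrite big_nil.
    rewrite (_ : (fun _ => _) =
        fun z : 'rV[R]_D => a j * z 0 j + \sum_(j <- r) a j * z 0 j); last first.
      by apply/funext => z; rewrite big_cons.
    move=> y; apply: (@continuousD R R 'rV[R]_D _ _ y); last exact: IH.
    apply: (@continuousM R 'rV[R]_D (cst (a j)) (fun z => z 0 j) y).
      exact: cst_continuous.
    exact: coord_continuous.
  exact: h.
have -> : 'd (bary Delta i) x v = l v.
  rewrite (_ : bary Delta i = (L : 'rV[R]_D -> R) + cst b); last first.
    by apply/funext => y; rewrite ab.
  rewrite diffD; [|exact: linear_differentiable|exact: differentiable_cst].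
  by rewrite diff_lin // diff_cst /= addr0.
have lD : l (x + v) = l x + l v by exact: (linearD L).
have abl y : bary Delta i y = l y + b by exact: ab.
by rewrite !abl lD opprD addrACA subrr addr0 addrAC subrr add0r.
Qed.

End BaryTheory.

Notation face D := {set 'I_D.+1}.
Notation multi_index D := {ffun 'I_D.+1 -> nat}.

Section Labels.
Variable D : nat.
Implicit Types (f : face D) (a : multi_index D).

Definition fdim f : nat := #|f|.-1.

(* The smallest label of f when f is nonempty; ord0 if f is empty. *)
Definition fmin f : 'I_D.+1 := [arg min_(i < ord0 in f) i]%N.

Definition degree a : nat := (\sum_i a i)%N.

Definition supp a : face D := [set i | (0 < a i)%N]%SET.

Definition indic a : multi_index D := [ffun i => nat_of_bool (0 < a i)%N].

Definition binary a : Prop := forall i, (a i <= 1)%N.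

End Labels.

(* psi(xi; f, k, s) carries its argument (f, k, s), since being anchored is a
   property of the argument; [form] is the underlying differential 1-form on
   R^D, mapping a point and a tangent vector to a scalar. *)
Record directional_form (R : realType) (D : nat) (Delta : simplex R D) := Psi {
  psi_face : face D;
  psi_dir : 'I_D.+1;
  psi_bin : multi_index D
}.
Arguments Psi {R D} Delta f k s : rename.

Definition form (R : realType) (D : nat) (Delta : simplex R D)
    (psi : directional_form Delta) : 'rV[R]_D -> 'rV[R]_D -> R :=
  let: Psi f k s := psi in
  fun x v => 'd (bary Delta k) x v
    - (s k)%:R / (degree s)%:R * \sum_(j in f) 'd (bary Delta j) x v.

Definition anchored (R : realType) (D : nat) (Delta : simplex R D)
    (psi : directional_form Delta) : Prop :=
  let: Psi f k s := psi in forall i : 'I_D.+1, (i < fmin (f :\ k))%N -> s i = 0%N.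

Definition triplets (R : realType) (D : nat) (Delta : simplex R D) (r : nat) :
    set (face D * 'I_D.+1 * multi_index D) :=
  fun t => let: (f, k, a) := t in
    [/\ (1 <= fdim f)%N, k \in f, degree a = r & supp a :|: [set k] = f].

Definition anchored_triplets (R : realType) (D : nat) (Delta : simplex R D)
    (r : nat) : set (face D * 'I_D.+1 * multi_index D) :=
  fun t => let: (f, k, a) := t in
    triplets Delta r t /\ anchored (Psi Delta f k (indic a)).

(* Main.v *)
Require Import Defs.
From mathcomp Require Import all_boot all_order all_algebra.
From mathcomp Require Import all_classical all_reals all_analysis.

(** Anchoring fails exactly when some [i] in the support of [s] precedes the minimum of [f :\ k].
    Such an [i] lies in [f] but not in [f :\ k], so [i = k]. Then [k] is in the support, which is
    therefore all of [f], and [fmin_lt_setD1] turns [k] preceding the other labels into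
    [k = fmin f]. Conversely [k] itself is such an [i]. Triplets are the case [s = indic alpha], by
    [supp_indic]. *)

Section FaceMinimum.
Variable D : nat.
Implicit Types (f : {set 'I_D.+1}) (s : {ffun 'I_D.+1 -> nat}).

(* [arg_minnP] does not apply: [fmin] uses the base point [ord0], which need
   not belong to [f]. *)
Lemma fmin_spec {f} {i : 'I_D.+1} : i \in f ->
  fmin f \in f /\ forall j : 'I_D.+1, j \in f -> (fmin f <= j)%N.
Proof.
move=> fi; rewrite /fmin /arg_min /extremum.
case: pickP => [m /andP[fm /forallP lem] | nom] /=.
  by split=> // j fj; have /implyP := lem j; apply.
(* Minimising from [i], which is in [f], yields the minimiser whose existence [nom] denies. *)
have [m fm lem] := @arg_minnP _ i (fun j => j \in f) val fi.
by have /negP[] := nom m; rewrite /= fm; apply/forallP => j; apply/implyP/lem.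
Qed.

Lemma fmin_in {f} {i : 'I_D.+1} : i \in f -> fmin f \in f.
Proof. by case/fmin_spec. Qed.

Lemma fmin_le {f} {i : 'I_D.+1} : i \in f -> (fmin f <= i)%N.
Proof. by move=> fi; have [_] := fmin_spec fi; apply. Qed.

(** Positive dimension makes [f :\ k] nonempty, so its [fmin] is a genuine minimum and not the
    default [ord0]. *)
Lemma fmin_lt_setD1 {f} {k : 'I_D.+1} : (1 <= fdim f)%N -> k \in f ->
  (k < fmin (f :\ k)%SET)%N = (k == fmin f).
Proof.
rewrite /fdim (cardsD1 k) => + fk; rewrite fk => /card_gt0P[j fkj].
have /setD1P[mNk fm] := fmin_in fkj.
apply/idP/eqP => [ltkm | kE].
  apply/val_inj/eqP; rewrite eqn_leq (fmin_le fk) andbT.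
  have [-> // | neq] := eqVneq (fmin f) k.
  have fk_min : fmin f \in (f :\ k)%SET by rewrite !inE neq (fmin_in fk).
  by rewrite (leq_trans (ltnW ltkm)) // fmin_le.
by rewrite ltn_neqAle eq_sym mNk /= [in X in (X <= _)%N]kE fmin_le.
Qed.

Lemma supp_indic s : supp (Defs.indic s) = supp s.
Proof. by apply/setP => i; rewrite !inE ffunE; case: (s i). Qed.

End FaceMinimum.

(* All labels below [min (f \ k)] other than [k] lie outside [f], hence outside
   the support of [s]: only the label [k] can break anchoring. *)
Lemma not_anchoredP (R : realType) (D : nat) (Delta : simplex R D)
    (f : {set 'I_D.+1}) (k : 'I_D.+1) (s : {ffun 'I_D.+1 -> nat}) :
  (1 <= fdim f)%N -> k \in f -> supp s :|: [set k]%SET = f ->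
  ~ anchored (Psi Delta f k s) <-> supp s = f /\ k = fmin f.
Proof.
move=> dimf fk sf; split=> [/existsNP[i /not_implyP[ltim /eqP]] | [sE kE] anch].
  rewrite -lt0n => si0.
  have fi : i \in f by rewrite -sf !inE si0.
  have ik : i = k.
    apply/eqP/negPn/negP => iNk; move: ltim; rewrite ltnNge fmin_le //.
    by rewrite !inE iNk.
  subst i; split; last by apply/eqP; rewrite -fmin_lt_setD1.
  (* Since [s k] is positive, adjoining [k] does not enlarge the support. *)
  by rewrite -sf; apply/esym/finset.setUidPl; rewrite finset.sub1set inE.
have /anch sk0 : (k < fmin (f :\ k)%SET)%N by rewrite fmin_lt_setD1 // -kE.
by move: fk; rewrite -sE inE sk0.
Qed.

Theorem theorem3 (R : realType) (D r : nat) (hD : (1 <= D)%N) (hr : (1 <= r)%N)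
    (Delta : simplex R D) :
  (forall (f : {set 'I_D.+1}) (k : 'I_D.+1) (s : {ffun 'I_D.+1 -> nat}),
     (1 <= fdim f)%N -> k \in f -> binary s -> supp s :|: [set k]%SET = f ->
     ~ anchored (Psi Delta f k s) <-> supp s = f /\ k = fmin f)
  /\
  (forall (f : {set 'I_D.+1}) (k : 'I_D.+1) (alpha : {ffun 'I_D.+1 -> nat}),
     triplets Delta r (f, k, alpha) ->
     anchored_triplets Delta r (f, k, alpha) <->
       supp alpha <> f \/ k <> fmin f).
Proof.
split=> [f k s dimf fk _ sf | f k a tr]; first exact: not_anchoredP.
have [dimf fk _ af] := tr.
have := @not_anchoredP R D Delta f k (Defs.indic a) dimf fk.
(* De Morgan and double negation, both classical, turn the disjunction into anchoring. *)
rewrite supp_indic => /(_ af) nanchP; rewrite -not_andP -nanchP notK.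
by split=> [[] | ].
Qed.
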